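(* Let $d\ge 2$, $t\ge 1$ and $n\ge 1$ be integers with $n\le 2t-2$. Then the directed de Bruijn graph $\vec{\mathcal B}(d,n)$ has no $t$-identifying code.
   Context: $\mathcal A_d=\{0,1,\dots,d-1\}$. The directed de Bruijn graph $\vec{\mathcal B}(d,n)$ has vertex set $\mathcal A_d^n$ (strings of length $n$ over $\mathcal A_d$) and an arc from $x_1\cdots x_n$ to $y_1\cdots y_n$ iff $x_2\cdots x_n=y_1\cdots y_{n-1}$. $\vec d(u,v)$ is the length of a shortest directed walk from $u$ to $v$; $B_t^-(v)=\{u:\vec d(u,v)\le t\}$; for $S\subseteq V$, $\mathrm{ID}_S(v)=B_t^-(v)\cap S$; a $t$-identifying code is a set $S$ with $\mathrm{ID}_S(v)\ne\emptyset$ for all $v$ and $\mathrm{ID}_S(u)\ne\mathrm{ID}_S(v)$ for all $u\ne v$. *)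

(* Defs.v *)
From mathcomp Require Import all_boot.

Set Implicit Arguments.
Unset Strict Implicit.
Unset Printing Implicit Defensive.

Section Digraph.
Variables (T : finType) (arc : rel T).

(* The walk is u :: p, so its length (number of arcs) is size p = k. *)
Definition has_walk (k : nat) (u v : T) : bool :=
  [exists p : k.-tuple T, path arc u p && (last u p == v)].

Lemma has_walkP k u v :
  reflect (exists p : seq T, [/\ size p = k, path arc u p & last u p = v])
          (has_walk k u v).
Proof.
apply: (iffP existsP) => [[p /andP[Hp /eqP Hl]]|[p [Hs Hp Hl]]].
  by exists p; rewrite size_tuple.
have Hs' : size p == k by apply/eqP.
by exists (Tuple Hs'); rewrite /= Hp Hl eqxx.
Qed.

Lemma connect_has_walk u v : connect arc u v -> exists k, has_walk k u v.
Proof.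
case/connectP=> p Hp Hl; exists (size p).
by apply/has_walkP; exists p.
Qed.

(* None is the infinite distance. *)
Definition dist (u v : T) : option nat :=
  match @idP (connect arc u v) with
  | ReflectT uv => Some (ex_minn (connect_has_walk uv))
  | ReflectF _ => None
  end.

Definition in_ball (t : nat) (v : T) : {set T} :=
  [set u | if dist u v is Some k then k <= t else false].

Lemma in_ballP t u v :
  reflect (exists2 k, k <= t & has_walk k u v) (u \in in_ball t v).
Proof.
rewrite inE /dist; case: {-}_ / idP => [uv|nuv].
  case: ex_minnP => m Hm Hmin; apply: (iffP idP) => [le_mt|[k le_kt Hk]].
    by exists m.
  exact: leq_trans (Hmin k Hk) le_kt.
apply: (iffP idP) => // -[k _ /has_walkP[p [_ Hp Hl]]].
by case: nuv; apply/connectP; exists p.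
Qed.

Definition ID (t : nat) (S : {set T}) (v : T) : {set T} := in_ball t v :&: S.

Definition identifying_code (t : nat) (S : {set T}) : Prop :=
  (forall v, ID t S v <> set0) /\
  (forall u v, u <> v -> ID t S u <> ID t S v).

End Digraph.

Definition debruijn (d n : nat) : rel (n.-tuple 'I_d) :=
  fun x y => behead x == take n.-1 y.
Arguments debruijn : clear implicits.

(* Main.v *)
Require Import Defs.
From mathcomp Require Import all_boot zify.

(** A code cannot separate two vertices with equal in-balls.  Vertices [w a] and
    [w b] differing only in the last letter have the same in-neighbours, so
    their in-balls agree as soon as each of them reaches the other within [t]
    steps.  If [n <= t], everything is reachable.  Otherwise let [m = n - t], so
    that [2 m + 2 <= n], and take [w = 0^m 1 0^(n-m-2)]: the suffix [0^m] of
    [w 0] is a prefix of [w 1], and the suffix [0^m 1] of [w 1] is a prefix of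
    [w 0], giving walks of lengths [t] and [t - 1]. *)

Section Twins.
Variables (T : finType) (arc : rel T).

Lemma has_walk0 u : has_walk arc 0 u u.
Proof. by apply/has_walkP; exists [::]. Qed.

Lemma has_walkSr k u v :
  reflect (exists2 w, has_walk arc k u w & arc w v) (has_walk arc k.+1 u v).
Proof.
apply: (iffP (has_walkP _ _ _ _)) => [[p [szp pthp lstp]]|[w]].
  case/lastP: p szp pthp lstp => // p x.
  rewrite size_rcons rcons_path last_rcons => -[szp] /andP[pthp arcx] <-.
  by exists (last u p) => //; apply/has_walkP; exists p.
case/has_walkP=> p [szp pthp lstp] arcwv; exists (rcons p v).
by rewrite size_rcons rcons_path last_rcons szp pthp lstp.
Qed.

(** The last arc of a nonempty walk to [u] can be redirected to [v] at no cost in length. Only the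
    empty walk, whose start is [u] itself, needs [u \in in_ball arc t v]. *)
Lemma sub_in_ball t u v :
  arc^~ u =1 arc^~ v -> u \in in_ball arc t v ->
  in_ball arc t u \subset in_ball arc t v.
Proof.
move=> eq_uv uv; apply/subsetP => x /in_ballP[[|k] le_kt].
  by case/has_walkP=> p [/size0nil-> _ /= ->].
case/has_walkSr=> w xw; rewrite [arc w u]eq_uv => wv.
by apply/in_ballP; exists k.+1 => //; apply/has_walkSr; exists w.
Qed.

Lemma twins_no_identifying_code t u v :
  u <> v -> arc^~ u =1 arc^~ v ->
  u \in in_ball arc t v -> v \in in_ball arc t u ->
  ~ exists S : {set T}, identifying_code arc t S.
Proof.
move=> neq_uv eq_uv uv vu [S [_ /(_ u v neq_uv)]]; apply.
suff eqB : in_ball arc t u = in_ball arc t v by rewrite /ID eqB.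
apply/eqP; rewrite eqEsubset !sub_in_ball // => x; exact/esym/eq_uv.
Qed.

End Twins.

(** Each arc shifts one letter out, so [k] arcs suffice when the last [n.+1 - k] letters of [u] open
    [v]. For [k > n] the overlap is empty and the condition holds trivially. The induction peels off
    the last arc. *)
Lemma debruijn_has_walk d n k (u v : n.+1.-tuple 'I_d) :
  drop k u = take (n.+1 - k) v -> has_walk (debruijn d n.+1) k u v.
Proof.
elim: k v => [|k IHk] v.
  rewrite drop0 subn0 take_oversize ?size_tuple // => /val_inj ->.
  exact: has_walk0.
rewrite subSS => uv; apply/has_walkSr.
(* The predecessor of [v] on the walk must start with letter [k] of [u], which lengthens the overlap
   by one. For [k > n] any letter would do, and the default is taken. *)
pose a := nth (thead u) u k.
have szw : size (a :: take n v) == n.+1.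
  by rewrite /= size_takel // size_tuple.
exists (Tuple szw); last by rewrite /debruijn /=.
apply: IHk => /=; case: (leqP k n) => [le_kn|lt_nk].
  rewrite subSn //= take_takel ?leq_subr // -uv.
  by rewrite (drop_nth (thead u)) // size_tuple.
by rewrite (eqP lt_nk) drop_oversize // size_tuple.
Qed.

Lemma debruijn_rcons d n (w : n.-tuple 'I_d) a (x : n.+1.-tuple 'I_d) :
  debruijn d n.+1 x [tuple of rcons w a] = (behead x == w).
Proof. by rewrite /debruijn /= -cats1 take_size_cat // size_tuple. Qed.

Lemma debruijn_no_identifying_code d n t k l (w : n.-tuple 'I_d) (a b : 'I_d) :
  a <> b -> k <= t -> l <= t ->
  drop k (rcons w a) = take (n.+1 - k) (rcons w b) ->
  drop l (rcons w b) = take (n.+1 - l) (rcons w a) ->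
  ~ exists S : {set n.+1.-tuple 'I_d}, identifying_code (debruijn d n.+1) t S.
Proof.
move=> neq_ab le_kt le_lt ab ba.
apply: (@twins_no_identifying_code _ _ _ [tuple of rcons w a] [tuple of rcons w b]).
- by move/(congr1 val)/rcons_inj => -[].
- by move=> x /=; rewrite !debruijn_rcons.
- by apply/in_ballP; exists k => //; apply: debruijn_has_walk.
- by apply/in_ballP; exists l => //; apply: debruijn_has_walk.
Qed.

Theorem theorem3p13 (d t n : nat)
    (hd : 2 <= d) (ht : 1 <= t) (hn : 1 <= n) (hnt : n <= 2 * t - 2) :
  ~ exists S : {set n.-tuple 'I_d}, identifying_code (debruijn d n) t S.
Proof.
case: n hn hnt => // n _ hnt.
pose o : 'I_d := Ordinal (ltnW hd); pose i : 'I_d := Ordinal hd.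
have neq_oi : o <> i by [].
case: (leqP n.+1 t) => [le_nt|lt_tn].
  (* After [n.+1] steps both required overlaps are empty, so any [w] would do. *)
  apply: (@debruijn_no_identifying_code _ _ _ n.+1 n.+1 [tuple of nseq n o] o i) => //=;
    by rewrite subnn take0 drop_oversize // size_rcons size_nseq.
(* The string length is now [n.+1], and [hnt] gives [2 * m + 1 <= n], so no subtraction truncates.
   The final zeros of [w] are split into blocks of [r] and [m] to expose the suffix used below. *)
pose m := n.+1 - t; pose r := n - m.+1 - m.
have szw : size (nseq m o ++ i :: nseq r o ++ nseq m o) == n.
  by rewrite size_cat /= size_cat !size_nseq /r /m; lia.
have dropE (s1 s2 : seq 'I_d) k : size s1 = k -> drop k (s1 ++ s2) = s2.
  by move=> <-; apply: drop_size_cat.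
have takeE (s1 s2 : seq 'I_d) k : size s1 = k -> take k (s1 ++ s2) = s1.
  by move=> <-; apply: take_size_cat.
have nseqSr : nseq m o ++ [:: o] = o :: nseq m o by elim: (m) => //= p ->.
apply: (@debruijn_no_identifying_code _ _ _ t t.-1 (Tuple szw) o i) => //=.
- lia.
(* The appended [o] moves in front of the last block, leaving a prefix of length [m + r + 2 = t]. *)
- have -> : rcons (nseq m o ++ i :: nseq r o ++ nseq m o) o
      = (nseq m o ++ i :: nseq r o ++ [:: o]) ++ nseq m o.
    by rewrite -cats1 -!catA /= -!catA nseqSr.
  rewrite dropE; last by rewrite size_cat /= size_cat !size_nseq /= /r /m; lia.
  by rewrite rcons_cat takeE // size_nseq.
(* Here the appended [i] stays in the suffix, so the overlap has [m.+1] letters and the dropped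
   prefix only [t.-1]. *)
- have -> : rcons (nseq m o ++ i :: nseq r o ++ nseq m o) i
      = (nseq m o ++ i :: nseq r o) ++ rcons (nseq m o) i.
    by rewrite -!cats1 -!catA /= -!catA.
  rewrite dropE; last by rewrite size_cat /= !size_nseq /r /m; lia.
  rewrite rcons_cat /= -cat_rcons takeE // size_rcons size_nseq /m; lia.
Qed.
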